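(* (a) For real $\nu\ge s>0$ and real $\lambda>-1/2$, one has for $x\in(-1,1)$ $${}_xI_1^{s}\big\{\omega_\lambda(x)\,{}^{r}G_\nu^{(\lambda)}(x)\big\}=h_\lambda^{(-s)}\,\omega_{\lambda+s}(x)\,{}^{r}G_{\nu-s}^{(\lambda+s)}(x),$$ $${}_{-1}I_x^{s}\big\{\omega_\lambda(x)\,{}^{l}G_\nu^{(\lambda)}(x)\big\}=(-1)^{[\nu]+[\nu-s]}\,h_\lambda^{(-s)}\,\omega_{\lambda+s}(x)\,{}^{l}G_{\nu-s}^{(\lambda+s)}(x).$$ (b) For real $s>0$, real $\lambda>s-1/2$ and real $\nu\ge0$, one has for $x\in(-1,1)$ $${}_x^RD_1^{s}\big\{\omega_\lambda(x)\,{}^{r}G_\nu^{(\lambda)}(x)\big\}=h_\lambda^{(s)}\,\omega_{\lambda-s}(x)\,{}^{r}G_{\nu+s}^{(\lambda-s)}(x),$$ $${}_{-1}^{\ \ R}D_x^{s}\big\{\omega_\lambda(x)\,{}^{l}G_\nu^{(\lambda)}(x)\big\}=(-1)^{[\nu]+[\nu+s]}\,h_\lambda^{(s)}\,\omega_{\lambda-s}(x)\,{}^{l}G_{\nu+s}^{(\lambda-s)}(x).$$ Here $\omega_\alpha(x)=(1-x^2)^{\alpha-1/2}$ and $h_\lambda^{(\beta)}=\dfrac{2^\beta\,\Gamma(\lambda+1/2)}{\Gamma(\lambda-\beta+1/2)}$.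
   Context: $[\nu]$ is the largest integer $\le\nu$. Generalised Gegenbauer functions of fractional degree: for real $\lambda>-1/2$, $\nu\ge 0$ and $x\in(-1,1)$, $${}^{r}G_\nu^{(\lambda)}(x)={}_2F_1\big(-\nu,\nu+2\lambda;\lambda+\tfrac12;\tfrac{1-x}{2}\big),\qquad {}^{l}G_\nu^{(\lambda)}(x)=(-1)^{[\nu]}{}_2F_1\big(-\nu,\nu+2\lambda;\lambda+\tfrac12;\tfrac{1+x}{2}\big),$$ where ${}_2F_1(a,b;c;z)=\sum_{j\ge0}\frac{(a)_j(b)_j}{(c)_j}\frac{z^j}{j!}$ and $(a)_0=1$, $(a)_j=a(a+1)\cdots(a+j-1)$. Riemann–Liouville fractional integrals of order $s>0$ on $(-1,1)$: $${}_{-1}I_x^su(x)=\frac1{\Gamma(s)}\int_{-1}^x\frac{u(y)}{(x-y)^{1-s}}dy,\qquad {}_xI_1^su(x)=\frac1{\Gamma(s)}\int_x^1\frac{u(y)}{(y-x)^{1-s}}dy.$$ Riemann–Liouville fractional derivatives of order $s\in[k-1,k)$, $k$ a positive integer: $${}_{-1}^{\ \ R}D_x^su=\frac{d^k}{dx^k}\big\{{}_{-1}I_x^{k-s}u\big\},\qquad {}_x^RD_1^su=(-1)^k\frac{d^k}{dx^k}\big\{{}_xI_1^{k-s}u\big\}.$$ *)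

(* Defs.v *)
From HB Require Import structures.
From mathcomp Require Import all_boot all_order all_algebra.
From mathcomp Require Import all_classical all_reals all_analysis.

Set Implicit Arguments.
Unset Strict Implicit.
Unset Printing Implicit Defensive.

Import Order.TTheory GRing.Theory Num.Theory.
Import numFieldNormedType.Exports.

Local Open Scope classical_set_scope.
Local Open Scope ring_scope.

Section Definitions.
Variable R : realType.
Implicit Types (a b c z s x y nu lambda alpha beta : R) (u : R -> R) (j : nat).

Local Notation mu := (@lebesgue_measure R).

(* Euler's integral; it converges exactly when 0 < s, and the library's
   convention for divergent integrals makes it 0 otherwise. *)
Definition Gamma s : R :=
  \int[mu]_(t in `]0, +oo[) (t `^ (s - 1) * expR (- t)).

Definition pochhammer a j : R := \prod_(i < j) (a + i%:R).

(* Meaningful for `|z| < 1 when c is not a nonpositive integer. *)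
Definition hyp2F1 a b c z : R :=
  limn (series (fun j =>
    pochhammer a j * pochhammer b j / pochhammer c j * (z ^+ j / (j`!)%:R))).

(* "r" and "l" stand for right and left throughout. *)
Definition rG lambda nu x : R :=
  hyp2F1 (- nu) (nu + 2 * lambda) (lambda + 1 / 2) ((1 - x) / 2).

Definition lG lambda nu x : R :=
  (-1) ^ (Num.floor nu) *
  hyp2F1 (- nu) (nu + 2 * lambda) (lambda + 1 / 2) ((1 + x) / 2).

Definition omega alpha x : R := (1 - x ^+ 2) `^ (alpha - 1 / 2).

Definition hcoef lambda beta : R :=
  2 `^ beta * Gamma (lambda + 1 / 2) / Gamma (lambda - beta + 1 / 2).

Definition RLint_l s u x : R :=
  (Gamma s)^-1 * \int[mu]_(y in `]-1, x[) (u y / (x - y) `^ (1 - s)).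

Definition RLint_r s u x : R :=
  (Gamma s)^-1 * \int[mu]_(y in `]x, 1[) (u y / (y - x) `^ (1 - s)).

(* Integrals and derivatives are total functions in the library, with default
   values where they do not exist, so existence is expressed separately. *)
Definition RLintegrable_l s u x : Prop :=
  mu.-integrable `]-1, x[ (fun y => (u y / (x - y) `^ (1 - s))%:E).

Definition RLintegrable_r s u x : Prop :=
  mu.-integrable `]x, 1[ (fun y => (u y / (y - x) `^ (1 - s))%:E).

(* The positive integer k with k - 1 <= s < k. *)
Definition RLorder s : nat := (Num.truncn s).+1.

Lemma RLorder_itv s : 0 <= s -> (RLorder s)%:R - 1 <= s < (RLorder s)%:R.
Proof. by move=> /truncn_itv; rewrite /RLorder -[X in X - 1]natr1 addrK. Qed.

Definition RLder_l s u x : R :=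
  let k := RLorder s in derive1n k (RLint_l (k%:R - s) u) x.

Definition RLder_r s u x : R :=
  let k := RLorder s in (-1) ^+ k * derive1n k (RLint_r (k%:R - s) u) x.

Definition derivable_upto (k : nat) (f : R -> R) : Prop :=
  forall i : nat, (i < k)%N ->
  forall x, -1 < x < 1 -> derivable (derive1n i f) x 1.

Definition RLderivable_l s u : Prop :=
  let k := RLorder s in
  (forall x, -1 < x < 1 -> RLintegrable_l (k%:R - s) u x) /\
  derivable_upto k (RLint_l (k%:R - s) u).

Definition RLderivable_r s u : Prop :=
  let k := RLorder s in
  (forall x, -1 < x < 1 -> RLintegrable_r (k%:R - s) u x) /\
  derivable_upto k (RLint_r (k%:R - s) u).

End Definitions.

(* Main.v *)
Require Import Defs.
From HB Require Import structures.
From mathcomp Require Import all_boot all_order all_algebra.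
From mathcomp Require Import all_classical all_reals all_analysis.
From mathcomp Require Import measurable_realfun ring lra.

Set Implicit Arguments.
Unset Strict Implicit.
Unset Printing Implicit Defensive.

Import Order.TTheory GRing.Theory Num.Theory.
Import numFieldNormedType.Exports.

Local Open Scope classical_set_scope.
Local Open Scope ring_scope.

(** Put c = lambda + 1/2, A = c + nu, B = 1 - c - nu and t = (1 - y) / 2, and
    write F for the Gauss function 2F1. As 1 - y^2 = 4 t (1 - t), the weight
    carries a factor (1 - t)^(c - 1), which is exactly what Euler's
    transformation F(c - A, c - B; c; t) = (1 - t)^(A + B - c) F(A, B; c; t)
    removes. Hence, on ]-1, 1[,
      omega_lambda * rG_nu^lambda = 2^(c - 1) (1 - y)^(c - 1) F(A, B; c; t)
    (lemma [omega_rG]). Passing from (lambda, nu) to (lambda + s, nu - s)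
    changes neither A nor B, because both depend on lambda + nu only: it just
    shifts c by s. So the four formulas describe how fractional integrals and
    derivatives shift the parameter c of [powhyp], the function
    (1 - y)^(c - 1) F(A, B; c; (1 - y) / 2).

    The right integral of order s sends c to c + s ([bateman_integral]): the
    series is integrated term by term, by dominated convergence, every term is
    a Beta integral, and the resulting factor Gamma(c + n) / Gamma(c + s + n)
    turns the Pochhammer symbol (c)_n into (c + s)_n, up to the constant
    Gamma(c) / Gamma(c + s). An ordinary derivative sends c to c - 1, up to a
    constant ([is_derive_powhyp]). The derivative of order s is an integral of
    order k - s followed by k ordinary derivatives, so it sends c to c - s; as
    c - s > 0, no intermediate parameter leaves the domain. The left versions
    follow from the right ones by the reflection y -> - y.

    Two classical facts carry this argument. The Beta integral
    ([integral_beta_itv]) comes from Tonelli's theorem applied to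
    Gamma(a) Gamma(b) seen as a convolution. Euler's transformation
    ([hyp2F1_euler]) comes from the Cauchy product of the binomial series of
    (1 - t)^(A + B - c) with the hypergeometric series, whose coefficients are
    summed by the Pfaff-Saalschutz identity ([pfaff_saalschutz]). *)

(** * Affine changes of variables for the Lebesgue integral *)

Section Substitution.
Context {R : realType}.
Local Notation mu := (@lebesgue_measure R).
Implicit Types f : R -> \bar R.

Lemma ge0_integral_opp f : measurable_fun setT f -> (forall x, 0 <= f x)%E ->
  (\int[mu]_x f (- x)%R = \int[mu]_x f x)%E.
Proof.
move=> mf f0.
transitivity (\int[pushforward mu (-%R : R -> measurableTypeR R)]_x f x)%E.
  by rewrite ge0_integral_pushforward.
by apply: eq_measure_integral => //= A mA _; exact: lebesgue_measureN.
Qed.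

(** Both sides are measures in A, so it is enough to compare them on half-open
    intervals. *)
Lemma lebesgue_measure_affine (a b : R) (a0 : 0 < a) (A : set R) : measurable A ->
  (a%:E * mu ((fun x => a * x + b)%R @^-1` A) = mu A)%E.
Proof.
move=> mA; apply/esym.
have mphi : measurable_fun [set: measurableTypeR R]
    ((fun x => a * x + b) : R -> measurableTypeR R).
  by apply: measurable_funD => //; exact: measurable_funM.
pose phi : {mfun measurableTypeR R >-> measurableTypeR R} :=
  HB.pack ((fun x => a * x + b) : R -> measurableTypeR R)
    (isMeasurableFun.Build _ _ _ _ _ mphi).
apply: (lebesgue_measure_unique
  (mu := mscale (NngNum (ltW a0)) (pushforward mu phi))) => //= _ [[p q]] _ <-.
rewrite /mscale/= /pushforward.
have -> : (fun x => a * x + b) @^-1` (`]p, q]%classic : set R) =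
    `](p - b) / a, (q - b) / a]%classic.
  apply/seteqP; split=> x /=; rewrite !in_itv/= ltr_pdivrMr// ler_pdivlMr//;
    move=> /andP[h1 h2]; apply/andP; split; lra.
rewrite !lebesgue_measure_itv/= !lte_fin ltr_pM2r ?invr_gt0//.
rewrite ltrD2r; case: ifPn => // pq; last by rewrite mule0.
by rewrite -!EFinB -EFinM; congr EFin; field; rewrite gt_eqF.
Qed.

Lemma ge0_integral_affine f (a b : R) : 0 < a ->
  measurable_fun setT f -> (forall x, 0 <= f x)%E ->
  (\int[mu]_x f x = a%:E * \int[mu]_x f (a * x + b)%R)%E.
Proof.
move=> a0 mf f0.
have mphi : measurable_fun [set: measurableTypeR R]
    ((fun x => a * x + b) : R -> measurableTypeR R).
  by apply: measurable_funD => //; exact: measurable_funM.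
pose phi x : measurableTypeR R := a * x + b.
(* The measure nu is abstracted so that its structure is inferred once, when
   [scaled] is applied to the pushforward. *)
have scaled (nu : {measure set (measurableTypeR R) -> \bar R}) :
    (nu : set _ -> \bar R) = pushforward mu phi ->
    (\int[mu]_x f x = a%:E * \int[nu]_x f x)%E.
  move=> nuE; rewrite -[a%:E]/(NngNum (ltW a0))%:num%:E -ge0_integral_mscale//=.
  apply: eq_measure_integral => //= A mA _; rewrite /mscale/= nuE; apply/esym.
  exact: lebesgue_measure_affine.
transitivity (a%:E * \int[pushforward mu phi]_x f x)%E.
  by apply: (scaled (pushforward mu phi)).
by rewrite ge0_integral_pushforward.
Qed.

End Substitution.

(** * The Gamma function *)

Section GammaFinite.
Context {R : realType}.
Local Notation mu := (@lebesgue_measure R).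
Implicit Types a t : R.

(** Extending t^(a - 1) by 0 to the whole line turns the Gamma and Beta
    integrals into integrals over R, the second one being a convolution. *)
Definition trunc_powR a t : R := if 0 < t then t `^ (a - 1) else 0.

Lemma trunc_powR_ge0 a t : 0 <= trunc_powR a t.
Proof. by rewrite /trunc_powR; case: ifP => // _; exact: powR_ge0. Qed.

Lemma measurable_trunc_powR a : measurable_fun setT (trunc_powR a).
Proof.
apply: measurable_fun_ifT => //; exact: measurable_fun_ltr.
Qed.

(** When a < 1 the integrand is unbounded at 0, so the fundamental theorem of
    calculus is used on [1 / (n + 2), 1], and n tends to infinity. *)
Lemma integral_powR a : 0 < a ->
  (\int[mu]_(t in `]0%R, 1%R]) (t `^ (a - 1))%:E = (a^-1)%:E)%E.
Proof.
move=> a0.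
pose F n : set R := `[(n.+2%:R)^-1, 1]%classic.
have e0 n : 0 < (n.+2%:R)^-1 :> R by rewrite invr_gt0 ltr0n.
have FE : \bigcup_n F n = `]0, 1]%classic.
  apply/seteqP; split=> [x [n _]|x]; rewrite /F/= !in_itv/=.
    by move=> /andP[h ->]; rewrite (lt_le_trans (e0 n) h).
  move=> /andP[x0 x1]; exists (Num.bound x^-1) => //=; rewrite in_itv/= x1 andbT.
  rewrite -[leRHS]invrK lef_pV2 ?posrE ?invr_gt0 ?ltr0n//.
  have /ltW := archi_boundP (ltW (etrans (invr_gt0 x) x0)).
  by move=> /le_trans; apply; rewrite ler_nat -addn2 leq_addr.
have ndF : nondecreasing_seq F.
  move=> m n mn; rewrite subsetEset /F => x /=; rewrite !in_itv/= => /andP[h ->].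
  rewrite andbT; apply: le_trans h; rewrite lef_pV2 ?posrE ?ltr0n// ler_nat.
  by rewrite !ltnS.
have d1 (x : R) : 0 < x ->
    is_derive x 1 (fun x => a^-1 * x `^ a) (x `^ (a - 1)).
  move=> x0; have p := is_derive1_powR a x0; apply: is_derive_eq.
  by rewrite [LHS]mulKf// gt_eqF.
have cts (b x : R) : 0 < x -> {for x, continuous (fun t => t `^ b)}.
  move=> x0; apply: differentiable_continuous; apply/derivable1_diffP.
  by apply: derivable_powR; rewrite in_itv/= x0.
have intF n : (\int[mu]_(t in F n) (t `^ (a - 1))%:E =
    (a^-1 - a^-1 * (n.+2%:R)^-1 `^ a)%:E)%E.
  rewrite /F (@continuous_FTC2 _ _ (fun x => a^-1 * x `^ a)).
  - by rewrite powR1 mulr1 -EFinB.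
  - by rewrite invf_lt1 ?ltr0n// ltr1n.
  - apply: continuous_in_subspaceT => x; rewrite inE/= in_itv/= => /andP[h _].
    by apply: cts; apply: lt_le_trans h.
  - split.
    + move=> x; rewrite in_itv/= => /andP[h _].
      by have [] := d1 x (lt_trans (e0 n) h).
    + apply: cvg_at_right_filter; apply: cvgMr; exact: cts.
    + apply: cvg_at_left_filter; apply: cvgMr; exact: cts.
  - move=> x; rewrite in_itv/= => /andP[h _]; rewrite derive1E.
    by have [_ ->] := d1 x (lt_trans (e0 n) h).
have cvF : (\int[mu]_(t in F i) (t `^ (a - 1))%:E)%E @[i --> \oo] -->
    (\int[mu]_(t in \bigcup_i F i) (t `^ (a - 1))%:E)%E.
  apply: ge0_nondecreasing_set_cvg_integral => //.
  - by move=> i; exact: measurable_itv.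
  - by move=> i; apply/measurable_EFinP; exact: measurable_funTS.
  - by move=> i x _; rewrite lee_fin powR_ge0.
rewrite (funext intF) FE in cvF.
apply: (cvg_unique _ cvF) => //.
apply: cvg_EFin; first exact: nearW.
rewrite -[X in _ --> X]subr0; apply: cvgB; first exact: cvg_cst.
rewrite -[X in _ --> X](mulr0 a^-1); apply: cvgMr.
have /cvg_at_rightP := powR_cvg0 a0; apply; split => //.
by have := @cvg_harmonic R; rewrite -(cvg_shiftS _).
Qed.

(** The extended-real integral, on which Tonelli applies before finiteness is
    known. *)
Definition egamma a : \bar R := (\int[mu]_t (trunc_powR a t * expR (- t))%:E)%E.

Lemma measurable_gamma_fun a :
  measurable_fun setT (fun t => trunc_powR a t * expR (- t)).
Proof.
apply: measurable_funM; first exact: measurable_trunc_powR.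
by apply: measurableT_comp => //; exact: measurableT_comp.
Qed.

Lemma GammaE a : Gamma a = fine (egamma a).
Proof.
rewrite /Gamma /Rintegral integral_mkcond /egamma; congr fine.
apply: eq_integral => t _; rewrite /patch /trunc_powR mem_setE in_itv/= andbT.
by case: ifP => //; rewrite mul0r.
Qed.

(** Near 0 the integrand is bounded by t^(a - 1), and beyond 1 by a multiple of
    exp(- t / 2). *)
Lemma egamma_lty a : 0 < a -> (egamma a < +oo)%E.
Proof.
move=> a0.
(* With this m, the bound ln t <= t / m + ln m gives
   (a - 1) ln t <= t / 2 + |a - 1| ln m. *)
pose m := 2 * `|a - 1| + 1.
have m0 : 0 < m by rewrite /m; have := normr_ge0 (a - 1); lra.
pose C := expR (`|a - 1| * ln m).
have bnd t : trunc_powR a t * expR (- t) <=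
    ((fun t => t `^ (a - 1)) \_ `]0, 1]) t + 2 * C * exponential_pdf (1 / 2) t.
  have C0 : 0 <= 2 * C * exponential_pdf (1 / 2) t.
    by rewrite !mulr_ge0 ?expR_ge0 ?exponential_pdf_ge0//; lra.
  rewrite /trunc_powR /patch mem_setE in_itv/=.
  case: ifPn => [t0/=|_]; last by rewrite mul0r addr_ge0//=; case: ifP.
  case: ifPn => [t1|].
    rewrite -[leLHS]addr0 lerD// ler_piMr ?powR_ge0//.
    by rewrite -expR0 ler_expR; lra.
  rewrite -ltNge => t1; rewrite add0r exponential_pdfE; last by rewrite ltW.
  rewrite [leRHS](_ : _ = C * expR (- (1 / 2) * t)); last by field.
  rewrite /powR gt_eqF// /C -!expRD ler_expR.
  have lnt0 : 0 <= ln t by rewrite ln_ge0 ?ltW.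
  have : ln t <= t / m + ln m.
    have tm0 : 0 < t / m by rewrite divr_gt0.
    by have := ln_sublinear tm0; rewrite ln_div ?posrE//; lra.
  move=> lnt.
  have h1 : (a - 1) * ln t <= `|a - 1| * (t / m + ln m).
    apply: (le_trans (ler_wpM2r lnt0 (ler_norm _))).
    exact: ler_wpM2l.
  have h2 : `|a - 1| * (t / m) <= 1 / 2 * t.
    rewrite mulrCA mulrC ler_pM2r// ler_pdivrMr// /m.
    by have := normr_ge0 (a - 1); lra.
  by move: h1; rewrite mulrDr; lra.
apply: (@le_lt_trans _ _ (\int[mu]_t
  ((((fun t => t `^ (a - 1)) \_ `]0, 1]) t)%:E +
   (2 * C)%:E * (exponential_pdf (1 / 2) t)%:E))%E).
  apply: ge0_le_integral => //.
  - by move=> t _; rewrite lee_fin mulr_ge0 ?expR_ge0// trunc_powR_ge0.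
  - by apply/measurable_EFinP; exact: measurable_gamma_fun.
  - apply: emeasurable_funD.
      apply/measurable_EFinP; apply/(measurable_restrictT _ _).1 => //.
      exact: measurable_funTS.
    apply: measurable_funeM; apply/measurable_EFinP.
    exact: measurable_exponential_pdf.
  - by move=> t _; rewrite -EFinM -EFinD lee_fin.
rewrite ge0_integralD//=.
- rewrite ge0_integralZl_EFin//.
  + rewrite integral_exponential_pdf ?mule1; last by lra.
    rewrite lte_add_pinfty ?ltry//.
    have := integral_powR a0; rewrite integral_mkcond.
    by under eq_integral do rewrite restrict_EFin; move=> ->; rewrite ltry.
  + by move=> t _; rewrite lee_fin exponential_pdf_ge0//; lra.
  + by apply/measurable_EFinP; exact: measurable_exponential_pdf.
  + by rewrite mulr_ge0 ?expR_ge0.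
- by move=> t _; rewrite lee_fin; apply: restrict_ge0 => *; exact: powR_ge0.
- apply/measurable_EFinP; apply/(measurable_restrictT _ _).1 => //.
  exact: measurable_funTS.
- move=> t _; apply: mule_ge0; rewrite lee_fin.
    by rewrite mulr_ge0 ?expR_ge0.
  by apply: exponential_pdf_ge0; lra.
- apply: measurable_funeM; apply/measurable_EFinP.
  exact: measurable_exponential_pdf.
Qed.

(** On [1, 2] the integrand is at least exp(- 2 (|a - 1| + 1)), because
    0 <= ln t <= 2 there. *)
Lemma egamma_gt0 a : (0 < egamma a)%E.
Proof.
pose K := expR (- (2 * (`|a - 1| + 1))).
apply: (@lt_le_trans _ _ (\int[mu]_(t in `[1%R, 2%R]) K%:E)%E).
  rewrite integral_cst//= lebesgue_measure_itv/= lte_fin ltr1n -EFinB -EFinM.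
  by rewrite lte_fin mulr_gt0 ?expR_gt0//; lra.
rewrite integral_mkcond; apply: ge0_le_integral => //.
- by move=> t _; rewrite /patch; case: ifP => // _; rewrite lee_fin expR_ge0.
- by apply/(measurable_restrictT _ _).1 => //; exact: measurable_cst.
- by apply/measurable_EFinP; exact: measurable_gamma_fun.
move=> t _; rewrite /patch; case: ifPn => [|_]; last first.
  by rewrite lee_fin mulr_ge0 ?expR_ge0// trunc_powR_ge0.
rewrite inE/= in_itv/= => /andP[t1 t2]; have t0 : 0 < t by lra.
rewrite lee_fin /trunc_powR t0 /powR gt_eqF// -expRD ler_expR.
have ln0 : 0 <= ln t by rewrite ln_ge0.
have ln2 : ln t <= 2 by have := ln_sublinear t0; lra.
have : `|(a - 1) * ln t| <= `|a - 1| * 2.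
  by rewrite normrM ler_wpM2l// ger0_norm.
by rewrite ler_norml => /andP[]; lra.
Qed.

Lemma egamma_Gamma a : 0 < a -> egamma a = (Gamma a)%:E.
Proof.
by move=> a0; rewrite GammaE fineK// ge0_fin_numE ?egamma_lty// ltW// egamma_gt0.
Qed.

Lemma Gamma_gt0 a : 0 < a -> 0 < Gamma a.
Proof. by move=> a0; rewrite -lte_fin -egamma_Gamma// egamma_gt0. Qed.

Lemma Gamma1 : Gamma 1 = 1 :> R.
Proof.
rewrite GammaE -[RHS]/(fine 1%:E) -(@integral_exponential_pdf R 1)//.
congr fine; rewrite /exponential_pdf.
transitivity (\int[mu]_(t in `[0%R, +oo[) (1 * expR (- 1 * t))%:E)%E; last first.
  by rewrite integral_mkcond; under eq_integral do rewrite restrict_EFin.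
rewrite -integral_itv_obnd_cbnd; last first.
  apply/measurable_EFinP; apply: measurable_funM => //.
  by apply: measurableT_comp => //; exact: measurable_funM.
rewrite integral_mkcond; apply: eq_integral => t _; rewrite /patch/= /trunc_powR.
rewrite mem_setE in_itv/= andbT; case: ifP => _; last by rewrite mul0r.
by rewrite subrr powRr0 mulN1r.
Qed.

End GammaFinite.

(** * The Beta integral *)

Section BetaIntegral.
Context {R : realType}.
Local Notation mu := (@lebesgue_measure R).
Implicit Types a b t w : R.

Definition trunc_powR_conv a b w : \bar R :=
  (\int[mu]_u (trunc_powR a u * trunc_powR b (w - u))%:E)%E.

Lemma trunc_powRM a w t : 0 < w ->
  trunc_powR a (w * t) = w `^ (a - 1) * trunc_powR a t.
Proof.
move=> w0; rewrite /trunc_powR pmulr_rgt0//.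
case: ifP => [t0|_]; last by rewrite mulr0.
by rewrite powRM// ltW.
Qed.

Lemma measurable_trunc_powR_conv a b w :
  measurable_fun setT (fun u => trunc_powR a u * trunc_powR b (w - u)).
Proof.
apply: measurable_funM; first exact: measurable_trunc_powR.
apply: measurableT_comp; first exact: measurable_trunc_powR.
exact: measurable_funB.
Qed.

(** Homogeneity of the convolution, by the substitution u -> w u. For w <= 0
    both sides vanish, as u and w - u cannot both be positive. *)
Lemma trunc_powR_conv_scale a b w :
  trunc_powR_conv a b w = ((trunc_powR (a + b) w)%:E * trunc_powR_conv a b 1)%E.
Proof.
rewrite /trunc_powR; case: ifPn => [w0|]; last first.
  rewrite -leNgt => w0; rewrite mul0e; apply: integral0_eq => u _.
  rewrite /trunc_powR; case: ifPn => [u0|]; last by rewrite mul0r.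
  by rewrite ifF ?mulr0//; apply/negbTE; rewrite -leNgt; lra.
rewrite /trunc_powR_conv (ge0_integral_affine 0 w0); last 2 first.
- by apply/measurable_EFinP; exact: measurable_trunc_powR_conv.
- by move=> u; rewrite lee_fin mulr_ge0 ?trunc_powR_ge0.
under eq_integral.
  move=> u _; rewrite addr0 -[X in X - w * u]mulr1 -mulrBr !trunc_powRM//.
  rewrite mulrACA EFinM; over.
rewrite ge0_integralZl_EFin ?mulr_ge0 ?powR_ge0//; last 2 first.
- by move=> u _; rewrite lee_fin mulr_ge0 ?trunc_powR_ge0.
- by apply/measurable_EFinP; exact: measurable_trunc_powR_conv.
rewrite muleA -EFinM; congr ((_)%:E * _)%E.
have -> : w * (w `^ (a - 1) * w `^ (b - 1)) =
    w `^ 1 * (w `^ (a - 1) * w `^ (b - 1)).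
  by rewrite powRr1// ltW.
by rewrite -!powRD ?(gt_eqF w0) ?implybT//; congr (_ `^ _); lra.
Qed.

(** The substitution v = w - u and Tonelli turn the double integral into the
    integral of exp(- w) times the convolution at w, which
    [trunc_powR_conv_scale] evaluates. *)
Lemma egammaM a b :
  (egamma a * egamma b = egamma (a + b) * trunc_powR_conv a b 1)%E.
Proof.
have mexp : measurable_fun setT (fun t : R => expR (- t)).
  by apply: measurableT_comp => //; exact: measurableT_comp.
pose f (z : R * R) :=
  (trunc_powR a z.1 * trunc_powR b (z.2 - z.1) * expR (- z.2))%:E.
have mf : measurable_fun setT f.
  apply/measurable_EFinP; apply: measurable_funM; last first.
    by apply: measurableT_comp => //; exact: measurableT_comp.
  apply: measurable_funM.
    by apply: measurableT_comp => //; exact: measurable_trunc_powR.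
  apply: measurableT_comp; first exact: measurable_trunc_powR.
  exact: measurable_funB.
have f0 z : (0 <= f z)%E by rewrite lee_fin !mulr_ge0 ?trunc_powR_ge0 ?expR_ge0.
transitivity (\int[mu]_u \int[mu]_w f (u, w))%E.
  rewrite {1}/egamma -ge0_integralZr//; last 3 first.
  - by apply/measurable_EFinP; exact: measurable_gamma_fun.
  - by move=> t _; rewrite lee_fin mulr_ge0 ?trunc_powR_ge0 ?expR_ge0.
  - apply: integral_ge0 => t _.
    by rewrite lee_fin mulr_ge0 ?trunc_powR_ge0 ?expR_ge0.
  apply: eq_integral => u _.
  rewrite /egamma (ge0_integral_affine (- u) ltr01); last 2 first.
  - by apply/measurable_EFinP; exact: measurable_gamma_fun.
  - by move=> t; rewrite lee_fin mulr_ge0 ?trunc_powR_ge0 ?expR_ge0.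
  rewrite mul1e -ge0_integralZl_EFin//; last 3 first.
  - by move=> t _; rewrite lee_fin mulr_ge0 ?trunc_powR_ge0 ?expR_ge0.
  - apply/measurable_EFinP; apply: (measurableT_comp (measurable_gamma_fun b)).
    by apply: measurable_funD => //; exact: measurable_funM.
  - by rewrite mulr_ge0 ?trunc_powR_ge0 ?expR_ge0.
  apply: eq_integral => w _; rewrite /f/= mul1r -EFinM mulrACA -expRD.
  by congr (_ * expR _)%:E; lra.
rewrite fubini_tonelli// /egamma -ge0_integralZr//; last 3 first.
- by apply/measurable_EFinP; exact: measurable_gamma_fun.
- by move=> t _; rewrite lee_fin mulr_ge0 ?trunc_powR_ge0 ?expR_ge0.
- by apply: integral_ge0 => t _; rewrite lee_fin mulr_ge0 ?trunc_powR_ge0.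
apply: eq_integral => w _; rewrite EFinM [in RHS]muleAC -trunc_powR_conv_scale.
rewrite /f /trunc_powR_conv -ge0_integralZr//=.
- by apply/measurable_EFinP; exact: measurable_trunc_powR_conv.
- by move=> t _; rewrite lee_fin mulr_ge0 ?trunc_powR_ge0.
Qed.

(** The convolution is finite because Gamma (a + b) is finite and positive. *)
Lemma trunc_powR_conv1E a b : 0 < a -> 0 < b ->
  trunc_powR_conv a b 1 = (Gamma a * Gamma b / Gamma (a + b))%:E.
Proof.
move=> a0 b0; have := egammaM a b; rewrite !egamma_Gamma ?addr_gt0// -EFinM.
have g0 := Gamma_gt0 (addr_gt0 a0 b0).
have : (0 <= trunc_powR_conv a b 1)%E.
  by apply: integral_ge0 => t _; rewrite lee_fin mulr_ge0 ?trunc_powR_ge0.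
case: (trunc_powR_conv a b 1) => [r _|_|//]; last by rewrite gt0_muley ?lte_fin.
by rewrite -EFinM => -[->]; rewrite mulrC mulKf// gt_eqF.
Qed.

(** The substitution u = z - y makes the left side the convolution at z - x. *)
Lemma integral_beta_itv a b x z : 0 < a -> 0 < b -> x < z ->
  (\int[mu]_(y in `]x, z[) ((z - y) `^ (a - 1) * (y - x) `^ (b - 1))%:E =
  ((z - x) `^ (a + b - 1) * (Gamma a * Gamma b / Gamma (a + b)))%:E)%E.
Proof.
move=> a0 b0 xz; rewrite integral_mkcond.
pose g u := (trunc_powR a u * trunc_powR b ((z - x) - u))%:E.
have g0 u : (0 <= g u)%E by rewrite lee_fin mulr_ge0 ?trunc_powR_ge0.
have mg : measurable_fun setT g.
  by apply/measurable_EFinP; exact: measurable_trunc_powR_conv.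
transitivity (\int[mu]_y (g (1 * (- y) + z)%R))%E.
  apply: eq_integral => y _; rewrite /patch mem_setE in_itv/= /g /trunc_powR.
  rewrite mul1r (addrC (- y)) (_ : z - x - (z - y) = y - x); last by lra.
  rewrite !subr_gt0 andbC; case: ifPn => [/andP[-> ->]//|].
  by rewrite negb_and => /orP[] /negbTE ->; rewrite ?mul0r ?mulr0.
rewrite (ge0_integral_opp (f := fun y => g (1 * y + z)%R))//; last first.
  apply: measurableT_comp => //.
  by apply: measurable_funD => //; exact: measurable_funM.
have := ge0_integral_affine z ltr01 mg g0; rewrite mul1e => <-.
rewrite -/(trunc_powR_conv a b (z - x)) trunc_powR_conv_scale trunc_powR_conv1E//.
by rewrite -EFinM {1}/trunc_powR subr_gt0 xz.
Qed.

(** The Beta integral with parameters 1 and a is 1 / a. *)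
Lemma GammaS a : 0 < a -> Gamma (a + 1) = a * Gamma a.
Proof.
move=> a0; have := integral_beta_itv ltr01 a0 (@ltr01 R).
under eq_integral do rewrite subrr powRr0 mul1r subr0.
rewrite integral_itv_bndo_bndc; last first.
  by apply/measurable_EFinP; exact: measurable_funTS.
rewrite integral_powR// subr0 powR1 mul1r Gamma1 mul1r addrC => -[].
move=> /(congr1 (fun x => x * a * Gamma (a + 1))).
rewrite mulVf ?gt_eqF// mul1r => ->.
by rewrite mulrAC divfK ?gt_eqF ?Gamma_gt0 ?addr_gt0// mulrC.
Qed.

End BetaIntegral.

(** * Hypergeometric series *)

Section Hypergeometric.
Context {R : realType}.
Implicit Types (a b c z r x : R) (u v : nat -> R).

Lemma ratio_test u r : 0 < r < 1 ->
  (\forall n \near \oo, `|u n.+1| <= r * `|u n|) -> cvgn [normed series u].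
Proof.
move=> /andP[r0 r1] [N _ HN].
(* This K makes the bound K r^n hold also before the ratio condition starts. *)
pose K := \sum_(i < N.+1) `|u i| / r ^+ i.
have K0 : 0 <= K by apply: sumr_ge0 => i _; rewrite divr_ge0// exprn_ge0// ltW.
have uK n : `|u n| <= K * r ^+ n.
  have [nN|Nn] := leqP n N.
    rewrite -ler_pdivrMr ?exprn_gt0//.
    rewrite /K (bigD1 (Ordinal (nN : n < N.+1)%N))//= lerDl sumr_ge0// => i _.
    by rewrite divr_ge0// exprn_ge0// ltW.
  have <- : (N + (n - N) = n)%N by rewrite subnKC// ltnW.
  elim: (n - N)%N => [|k IH].
    rewrite addn0 -ler_pdivrMr ?exprn_gt0//.
    rewrite /K big_ord_recr/= lerDr sumr_ge0// => i _.
    by rewrite divr_ge0// exprn_ge0// ltW.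
  rewrite addnS exprS mulrCA; apply: (le_trans (HN _ _)).
    by rewrite /= leq_addr.
  by rewrite ler_wpM2l// ltW.
apply: (@series_le_cvg _ _ (geometric K r)) => //=.
- by move=> n; rewrite /geometric/= mulr_ge0// exprn_ge0// ltW.
- by apply: is_cvg_geometric_series; rewrite ger0_norm// ltW.
Qed.

Lemma pochhammerS a n : pochhammer a n.+1 = pochhammer a n * (a + n%:R).
Proof. by rewrite /pochhammer big_ord_recr. Qed.

Lemma pochhammerSl a n : pochhammer a n.+1 = a * pochhammer (a + 1) n.
Proof.
rewrite /pochhammer big_ord_recl addr0; congr (_ * _).
by apply: eq_bigr => i _; rewrite -addrA nat1r.
Qed.

Lemma pochhammer_gt0 c n : 0 < c -> 0 < pochhammer c n.
Proof. by move=> c0; apply: prodr_gt0 => i _; rewrite ltr_wpDr. Qed.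

Definition hypcoef a b c n : R :=
  pochhammer a n * pochhammer b n / pochhammer c n / (n`!)%:R.

Lemma hyp2F1E a b c : hyp2F1 a b c = fun z => limn (pseries (hypcoef a b c) z).
Proof.
apply/funext => z; rewrite /hyp2F1 /pseries; congr (limn (series _)).
by apply/funext => j; rewrite /hypcoef/=; ring.
Qed.

Lemma hypcoef0 a b c : hypcoef a b c 0 = 1.
Proof. by rewrite /hypcoef /pochhammer !big_ord0 fact0 !divr1 mulr1. Qed.

Lemma hypcoefS a b c n : 0 < c ->
  hypcoef a b c n.+1 * ((c + n%:R) * n.+1%:R) =
  hypcoef a b c n * ((a + n%:R) * (b + n%:R)).
Proof.
move=> c0; rewrite /hypcoef !pochhammerS factS natrM -natr1.
have cn : c + n%:R != 0 by rewrite gt_eqF// ltr_wpDr.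
have n0 : n%:R + 1 != 0 :> R by rewrite natr1 pnatr_eq0.
have f0 : n`!%:R != 0 :> R by rewrite pnatr_eq0 -lt0n fact_gt0.
have p0 : pochhammer c n != 0 by rewrite gt_eqF// pochhammer_gt0.
by field; rewrite n0 cn f0 p0.
Qed.

Lemma hypcoefSE a b c n : 0 < c ->
  hypcoef a b c n.+1 =
  hypcoef a b c n * (((a + n%:R) * (b + n%:R)) / ((c + n%:R) * n.+1%:R)).
Proof.
move=> c0; rewrite mulrA -hypcoefS// mulfK// mulf_neq0 ?pnatr_eq0//.
by rewrite gt_eqF// ltr_wpDr.
Qed.

(** The ratio of consecutive terms tends to |z|, so it is eventually below any
    r in ]|z|, 1[. *)
Lemma normed_hyp2F1_cvg a b c z : 0 < c -> `|z| < 1 ->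
  cvgn [normed series (fun n => hypcoef a b c n * z ^+ n)]%R.
Proof.
move=> c0 z1; pose r := (`|z| + 1) / 2.
have z0 := normr_ge0 z.
have a0 := normr_ge0 a; have b0 := normr_ge0 b.
apply: (@ratio_test _ r); first by apply/andP; split; rewrite /r; lra.
(* Beyond M, |z| (|a| + n) (|b| + n) <= r n^2, and n^2 <= (c + n) (n + 1). *)
pose M := `|z| * (`|a| + `|b| + `|a| * `|b|) / (r - `|z|).
near=> n.
have n1 : 1 <= n%:R :> R.
  by rewrite (_ : 1 = 1%:R)// ler_nat; near: n; exact: nbhs_infty_ge.
have Mn : M <= n%:R by near: n; exact: nbhs_infty_ger.
rewrite hypcoefSE// exprS.
rewrite [X in `|X|](_ : _ = (hypcoef a b c n * z ^+ n) *
   (z * ((a + n%:R) * (b + n%:R) / ((c + n%:R) * n.+1%:R)))); last by ring.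
rewrite normrM mulrC ler_wpM2r//.
have cn : 0 < (c + n%:R) * n.+1%:R by rewrite mulr_gt0// ltr_wpDr.
rewrite mulrA normrM normfV (ger0_norm (ltW cn)) ler_pdivrMr//.
rewrite !normrM.
have h1 : `|a + n%:R| <= `|a| + n%:R.
  by apply: (le_trans (ler_normD _ _)); rewrite normr_nat.
have h2 : `|b + n%:R| <= `|b| + n%:R.
  by apply: (le_trans (ler_normD _ _)); rewrite normr_nat.
have h3 : `|a + n%:R| * `|b + n%:R| <= (`|a| + n%:R) * (`|b| + n%:R).
  exact: ler_pM.
apply: (le_trans (ler_wpM2l z0 h3)).
have rz : 0 < r - `|z| by rewrite /r; lra.
have r0 : 0 < r by rewrite /r; lra.
move: Mn; rewrite /M ler_pdivrMr// => Mn.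
have h4 : `|z| * (`|a| + `|b| + `|a| * `|b|) * n%:R <= n%:R * (r - `|z|) * n%:R.
  by rewrite ler_wpM2r.
have h5 : `|z| * (`|a| * `|b|) * 1 <= `|z| * (`|a| * `|b|) * n%:R.
  by rewrite ler_wpM2l// !mulr_ge0.
have h6 : r * (n%:R * n%:R) <= r * ((c + n%:R) * n.+1%:R).
  apply: ler_wpM2l; first exact: ltW.
  by apply: ler_pM => //; rewrite ?ler_nat// lerDr ltW.
by nra.
Unshelve. all: by end_near. Qed.

Lemma hyp2F1_cvg a b c z : 0 < c -> `|z| < 1 ->
  cvgn (pseries (hypcoef a b c) z).
Proof. by move=> c0 z1; apply: normed_cvg; exact: normed_hyp2F1_cvg. Qed.

Lemma pseries_diffs_hypcoef a b c : 0 < c ->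
  pseries_diffs (hypcoef a b c) =
  (a * b / c) *: hypcoef (a + 1) (b + 1) (c + 1).
Proof.
move=> c0; apply/funext => n; rewrite /pseries_diffs /hypcoef fctE.
rewrite !pochhammerSl factS natrM -natr1 /GRing.scale/=.
have n0 : n%:R + 1 != 0 :> R by rewrite natr1 pnatr_eq0.
have f0 : n`!%:R != 0 :> R by rewrite pnatr_eq0 -lt0n fact_gt0.
have p0 : pochhammer (c + 1) n != 0 by rewrite gt_eqF// pochhammer_gt0// addr_gt0.
by field; rewrite n0 f0 p0 gt_eqF.
Qed.

Lemma pseriesZ k u z : pseries (k *: u) z = k *: pseries u z.
Proof.
rewrite /pseries -seriesZ; congr series; apply/funext => n.
by rewrite !fctE /GRing.scale/= mulrA.
Qed.

Lemma is_derive_hyp2F1 a b c z : 0 < c -> `|z| < 1 ->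
  is_derive z 1 (hyp2F1 a b c) (a * b / c * hyp2F1 (a + 1) (b + 1) (c + 1) z).
Proof.
move=> c0 z1; pose K := (`|z| + 1) / 2; have z0 := normr_ge0 z.
have K0 : 0 <= K by rewrite /K; lra.
have K1 : `|K| < 1 by rewrite ger0_norm// /K; lra.
have c10 : 0 < c + 1 by rewrite addr_gt0.
have c20 : 0 < c + 1 + 1 by rewrite addr_gt0.
rewrite !hyp2F1E.
have -> : a * b / c * limn (pseries (hypcoef (a + 1) (b + 1) (c + 1)) z) =
    limn (pseries (pseries_diffs (hypcoef a b c)) z).
  rewrite pseries_diffs_hypcoef// pseriesZ limZl_tmp//; exact: hyp2F1_cvg.
have dZ k u : pseries_diffs (k *: u) = k *: pseries_diffs u.
  by apply/funext => n; rewrite /pseries_diffs !fctE /GRing.scale/= mulrCA.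
apply: (@pseries_snd_diffs _ _ K).
- exact: hyp2F1_cvg.
- rewrite pseries_diffs_hypcoef// pseriesZ; apply: is_cvgZr; exact: hyp2F1_cvg.
- rewrite pseries_diffs_hypcoef// dZ pseries_diffs_hypcoef// !pseriesZ.
  do 2 apply: is_cvgZr; exact: hyp2F1_cvg.
- by rewrite (ger0_norm K0) /K; lra.
Qed.

End Hypergeometric.

(** * Cauchy products *)

Section CauchyProduct.
Context {R : realType}.
Implicit Types (u v : nat -> R).

Definition cauchy_prod u v n := \sum_(0 <= i < n.+1) u i * v (n - i)%N.

Lemma series_cauchy_prod u v N :
  series (cauchy_prod u v) N = \sum_(0 <= i < N) u i * series v (N - i)%N.
Proof.
rewrite /series/= /cauchy_prod.
elim: N => [|N IH]; first by rewrite !big_geq.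
rewrite big_nat_recr//= IH [in RHS]big_nat_recr//= subSnn big_nat1.
rewrite [X in _ + X]big_nat_recr//= subnn addrA; congr (_ + _).
rewrite -big_split/= !big_mkord; apply: eq_bigr => i _.
by rewrite subSn ?(ltnW (ltn_ord i))// big_nat_recr//= mulrDr.
Qed.

(** The difference between the product of the partial sums and the partial sum
    of the Cauchy product is bounded by the same difference for the absolute
    values, whose partial sums are called A_n and B_n. There it is at most
    A_n B_n - A_h B_h with h = n / 2, since the triangle i + j < n contains the
    square i, j < h. *)
Lemma cvg_cauchy_prod u v :
  cvgn [normed series u] -> cvgn [normed series v] ->
  series (cauchy_prod u v) n @[n --> \oo] --> limn (series u) * limn (series v).
Proof.
move=> cu cv.
pose A := [normed series u]; pose B := [normed series v].
have B_nd : nondecreasing_seq B.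
  by apply: nondecreasing_series => *; exact: normr_ge0.
have A_ge0 n : 0 <= A n by apply: sumr_ge0 => i _; exact: normr_ge0.
have B_ge0 n : 0 <= B n by apply: sumr_ge0 => i _; exact: normr_ge0.
have AB : A n * B n - A n./2 * B n./2 @[n --> \oo] --> 0.
  have half : n./2 @[n --> \oo] --> \oo.
    move=> P [M _ HM]; exists M.*2 => // n /= Mn; apply: HM => /=.
    by rewrite -(doubleK M) half_leq.
  rewrite -(subrr (limn A * limn B)); apply: cvgB; apply: cvgM => //.
  - exact: (cvg_comp _ _ half cu).
  - exact: (cvg_comp _ _ half cv).
have bound n : `|series u n * series v n - series (cauchy_prod u v) n| <=
    A n * B n - A n./2 * B n./2.
  have {1}-> : series u n * series v n = \sum_(0 <= i < n) u i * series v n.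
    by rewrite /series/= mulr_suml.
  rewrite series_cauchy_prod -sumrB.
  apply: (@le_trans _ _ (\sum_(0 <= i < n) `|u i| * (B n - B (n - i)%N))).
    apply: (le_trans (ler_norm_sum _ _ _)); apply: ler_sum_nat => i /andP[_ ilt].
    rewrite -mulrBr normrM ler_wpM2l// /B /normed_series_of/= .
    rewrite !sub_series_geq ?leq_subr//; exact: ler_norm_sum.
  under eq_bigr do rewrite mulrBr; rewrite sumrB.
  rewrite -mulr_suml -/(A n) lerD2l lerN2.
  have hn : (n./2 <= n)%N.
    by rewrite leq_half_double (leq_trans _ (leqnSn _))// -addnn leq_addr.
  rewrite (big_cat_nat (leq0n _) hn)//= -[leLHS]addr0 lerD//; last first.
    by apply: sumr_ge0 => i _; rewrite mulr_ge0.
  rewrite mulr_suml; apply: ler_sum_nat => i /andP[_ ilt].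
  apply: ler_wpM2l; first exact: normr_ge0.
  apply: B_nd.
  rewrite (leq_trans _ (leq_sub2l n (ltnW ilt)))//.
  by rewrite leq_subRL// addnn -{2}(odd_double_half n) leq_addl.
have cuv : series u n * series v n @[n --> \oo] -->
    limn (series u) * limn (series v).
  by apply: cvgM; apply: normed_cvg.
apply: (cvg_sub0 _ cuv).
apply/norm_cvg0P.
apply: (squeeze_cvgr _ (cvg_cst 0) AB).
by apply: nearW => n /=; rewrite normr_ge0/= distrC bound.
Qed.

End CauchyProduct.

(** * Euler's transformation *)

Section Euler.
Context {R : realType}.
Implicit Types (a b c p t A B : R).

(** Both sides satisfy the same first order recurrence in n. For the left side
    this is creative telescoping: the recurrence applied to the k-th summand is
    the difference G (k + 1) - G k for the certificate G below. *)
Lemma pfaff_saalschutz A B c n : 0 < c ->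
  cauchy_prod (hypcoef A B c) (hypcoef (c - A - B) 1 1) n =
  hypcoef (c - A) (c - B) c n.
Proof.
move=> c0; set p := c - A - B.
set h := hypcoef A B c; set q := hypcoef p 1 1.
elim: n => [|n IH].
  by rewrite /cauchy_prod big_nat1 subnn /h /q !hypcoef0 mulr1.
have cn : (c + n%:R) * n.+1%:R != 0.
  by rewrite mulf_neq0 ?pnatr_eq0// gt_eqF// ltr_wpDr.
apply: (mulIf cn); rewrite hypcoefS// -IH.
have hS k : h k.+1 * ((c + k%:R) * k.+1%:R) = h k * ((A + k%:R) * (B + k%:R)).
  exact: hypcoefS.
have qS k : q k.+1 * k.+1%:R = q k * (p + k%:R).
  have k0 : 1 + k%:R != 0 :> R by rewrite nat1r pnatr_eq0.
  by apply: (mulIf k0); have := @hypcoefS R p 1 1 k ltr01; rewrite -!/(q _); lra.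
pose G k : R := - (k%:R * (c + k%:R - 1)) * h k * q (n.+1 - k)%N.
have tele k : (k <= n)%N ->
    h k * q (n.+1 - k)%N * ((c + n%:R) * n.+1%:R) -
    h k * q (n - k)%N * ((c - A + n%:R) * (c - B + n%:R)) = G k.+1 - G k.
  move=> kn; have := hS k; have := qS (n - k)%N.
  rewrite /G subSS subSn// -!natr1 natrB//; set Q := q (n - k).+1.
  move=> qE hE.
  have -> : - ((k%:R + 1) * (c + (k%:R + 1) - 1)) * h k.+1 * q (n - k)%N =
      - (h k * ((A + k%:R) * (B + k%:R))) * q (n - k)%N.
    by rewrite -hE; ring.
  have m0 : n%:R - k%:R + 1 != 0 :> R.
    by rewrite -natrB// natr1 pnatr_eq0.
  have -> : Q = q (n - k)%N * (p + (n%:R - k%:R)) / (n%:R - k%:R + 1).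
    by rewrite -qE mulfK.
  by rewrite /p; field.
have : \sum_(0 <= k < n.+1) (h k * q (n.+1 - k)%N * ((c + n%:R) * n.+1%:R) -
    h k * q (n - k)%N * ((c - A + n%:R) * (c - B + n%:R))) = G n.+1.
  rewrite (eq_big_nat _ _ (F2 := fun k => G k.+1 - G k)); last first.
    by move=> k /andP[_ kn]; exact: tele.
  by rewrite telescope_sumr// {2}/G !mul0r oppr0 !mul0r subr0.
rewrite sumrB -!mulr_suml => /eqP; rewrite subr_eq => /eqP E.
rewrite /cauchy_prod big_nat_recr//= mulrDl E subnn.
rewrite -/(cauchy_prod _ _) /G subnn -natr1; ring.
Qed.

(** Taking b = c makes F the binomial series; the choices c = 1 and c = 1 + 1
    give (1 - t)^(- p) and, up to a factor, its derivative. *)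
Lemma hypcoef_diag p c n : 0 < c -> hypcoef p c c n = pochhammer p n / n`!%:R.
Proof. by move=> c0; rewrite /hypcoef mulfK// gt_eqF// pochhammer_gt0. Qed.

(** The partial sums of the two sides differ by the single term
    t * (u n * t ^+ n), which tends to 0. *)
Lemma binomial_contiguous p t : `|t| < 1 ->
  (1 - t) * hyp2F1 (p + 1) (1 + 1) (1 + 1) t = hyp2F1 p 1 1 t.
Proof.
move=> t1; rewrite !hyp2F1E.
set u := hypcoef (p + 1) (1 + 1) (1 + 1); set v := hypcoef p 1 1.
have uE n : u n = pochhammer (p + 1) n / n`!%:R by rewrite /u hypcoef_diag.
have vE n : v n = pochhammer p n / n`!%:R by rewrite /v hypcoef_diag.
have cu : cvgn (pseries u t) by apply: hyp2F1_cvg.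
have cv : cvgn (pseries v t) by apply: hyp2F1_cvg.
have part n : pseries v t n.+1 = (1 - t) * pseries u t n.+1 + t * (u n * t ^+ n).
  rewrite /pseries/= /series/=; elim: n => [|n IH].
    by rewrite !big_nat1 !expr0 /u /v !hypcoef0; ring.
  rewrite big_nat_recr//= IH [in RHS]big_nat_recr//= mulrDr -!addrA; congr (_ + _).
  suff -> : v n.+1 = u n.+1 - u n by rewrite !exprS; ring.
  rewrite vE !uE pochhammerSl pochhammerS factS natrM -natr1.
  have n0 : n%:R + 1 != 0 :> R by rewrite natr1 pnatr_eq0.
  have f0 : n`!%:R != 0 :> R by rewrite pnatr_eq0 -lt0n fact_gt0.
  by field; rewrite n0 f0.
have c1 : (1 - t) * pseries u t n.+1 + t * (u n * t ^+ n) @[n --> \oo] -->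
    (1 - t) * limn (pseries u t) + t * 0.
  apply: cvgD; apply: cvgMr; first by rewrite (cvg_shiftS (pseries u t)).
  exact: (cvg_series_cvg_0 cu).
have c2 : pseries v t n.+1 @[n --> \oo] --> limn (pseries v t).
  by rewrite (cvg_shiftS (pseries v t)).
rewrite (funext part) in c2; rewrite mulr0 addr0 in c1.
exact: (cvg_unique _ c1 c2).
Qed.

Lemma hyp2F1_0 a b c : hyp2F1 a b c 0 = 1.
Proof.
rewrite hyp2F1E; apply/cvg_lim => //; rewrite -(cvg_shiftS _)/=.
apply: cvg_near_cst; apply: nearW => n; rewrite /pseries/= /series/=.
rewrite big_nat_recl//= big1 ?addr0; first by rewrite hypcoef0 mulr1.
by move=> i _; rewrite expr0n/= mulr0.
Qed.

(** By [binomial_contiguous], F(p, 1; 1; x) (1 - x)^p has derivative 0 on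
    [0, t], and its value at 0 is 1. *)
Lemma binomial_series p t : 0 <= t < 1 -> hyp2F1 p 1 1 t = (1 - t) `^ (- p).
Proof.
move=> /andP[t0 t1].
pose f x := hyp2F1 p 1 1 x * (1 - x) `^ p.
have df x : x \in `[0, t] -> is_derive x 1 f 0.
  rewrite in_itv/= => /andP[x0 xt].
  have x1 : `|x| < 1 by rewrite ger0_norm//; lra.
  have d1 := is_derive_hyp2F1 p 1 ltr01 x1.
  have x2 : 0 < 1 - x by lra.
  have d2 := is_derive1_powR p x2.
  have d3 : is_derive x 1 (fun x : R => 1 - x) (-1).
    by apply: is_derive_eq; rewrite add0r mul1r.
  have d4 := @is_derive1_comp _ _ (fun x => 1 - x) x _ _ d2 d3.
  have -> : f = hyp2F1 p 1 1 * ((fun x : R => x `^ p) \o (fun x => 1 - x)) by [].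
  apply: is_derive_eq.
  rewrite /GRing.scale/= -binomial_contiguous//.
  have -> : (1 - x) `^ p = (1 - x) * (1 - x) `^ (p - 1).
    rewrite -[X in X * _]powRr1 ?ltW// -powRD ?(gt_eqF x2) ?implybT//.
    by congr (_ `^ _); ring.
  by field.
have dfo x : x \in `]0, t[ -> is_derive x 1 f ((fun=> 0) x).
  by move=> /subset_itv_oo_cc; exact: df.
have cf : {within `[0, t], continuous f}.
  apply: continuous_in_subspaceT => x; rewrite inE => xt.
  apply: differentiable_continuous; apply/derivable1_diffP.
  by have [] := df x xt.
have [x _] := MVT_segment t0 dfo cf.
rewrite mul0r => /eqP; rewrite subr_eq0 /f subr0 powR1 hyp2F1_0 mulr1 => /eqP E.
have pn : (1 - t) `^ p != 0 by rewrite gt_eqF// powR_gt0// subr_gt0.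
by apply: (mulIf pn); rewrite E powRN mulVf.
Qed.

(** Compare coefficients: (1 - t)^(A + B - c) is the binomial series with
    p = c - A - B, and [pfaff_saalschutz] sums its Cauchy product with
    F(A, B; c; t). *)
Lemma hyp2F1_euler A B c t : 0 < c -> 0 <= t < 1 ->
  hyp2F1 (c - A) (c - B) c t = (1 - t) `^ (A + B - c) * hyp2F1 A B c t.
Proof.
move=> c0 t01; have t1 : `|t| < 1 by case/andP: t01 => *; rewrite ger0_norm.
have -> : A + B - c = - (c - A - B) by ring.
rewrite -binomial_series// mulrC !hyp2F1E.
have := @cvg_cauchy_prod R _ _ (@normed_hyp2F1_cvg _ A B c t c0 t1)
  (@normed_hyp2F1_cvg _ (c - A - B) 1 1 t ltr01 t1).
rewrite /pseries => /cvg_lim <- //; congr (limn (series _)).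
apply/funext => n; rewrite /= -pfaff_saalschutz// /cauchy_prod mulr_suml.
apply: eq_big_nat => i /andP[_ ilt].
by rewrite [RHS]mulrACA -exprD subnKC.
Qed.

End Euler.

(** * The basic functions and their derivatives *)

Section PowerTimesHypergeometric.
Context {R : realType}.
Implicit Types (a b c t x A B : R).

(** The second summand is t F'(t), so the coefficients on the left are those of
    F(A, B; c) multiplied by c - 1 + n, and
    (c - 1)_n (c - 1 + n) = (c - 1) (c)_n. *)
Lemma hyp2F1_contiguous A B c t : 1 < c -> `|t| < 1 ->
  (c - 1) * hyp2F1 A B c t +
    t * (A * B / c * hyp2F1 (A + 1) (B + 1) (c + 1) t) =
  (c - 1) * hyp2F1 A B (c - 1) t.
Proof.
move=> c1 t1; have c0 : 0 < c by exact: lt_trans c1.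
have cm : 0 < c - 1 by rewrite subr_gt0.
have cd : 0 < c + 1 by rewrite addr_gt0.
set u := hypcoef A B c.
have cu : cvgn (pseries u t) by apply: hyp2F1_cvg.
have cud : cvgn (pseries (pseries_diffs u) t).
  rewrite pseries_diffs_hypcoef// pseriesZ; apply: is_cvgZr; exact: hyp2F1_cvg.
have -> : A * B / c * hyp2F1 (A + 1) (B + 1) (c + 1) t =
    limn (pseries (pseries_diffs u) t).
  rewrite pseries_diffs_hypcoef// pseriesZ limZl_tmp ?hyp2F1E//.
  exact: hyp2F1_cvg.
rewrite !hyp2F1E -/u.
have cl : (c - 1) * pseries u t n +
    t * series (fun i => i%:R * u i * t ^+ i.-1) n @[n --> \oo] -->
    (c - 1) * limn (pseries u t) + t * limn (pseries (pseries_diffs u) t).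
  apply: cvgD; apply: cvgMr => //; exact: pseries_diffs_equiv.
have cr : (c - 1) * pseries (hypcoef A B (c - 1)) t n @[n --> \oo] -->
    (c - 1) * limn (pseries (hypcoef A B (c - 1)) t).
  by apply: cvgMr; exact: hyp2F1_cvg.
have part n : (c - 1) * pseries u t n +
    t * series (fun i => i%:R * u i * t ^+ i.-1) n =
    (c - 1) * pseries (hypcoef A B (c - 1)) t n.
  rewrite /pseries/= /series/= !mulr_sumr -big_split/=.
  apply: eq_big_nat => i _; rewrite /u /hypcoef.
  have -> : pochhammer c i = pochhammer (c - 1) i * (c - 1 + i%:R) / (c - 1).
    rewrite -pochhammerS pochhammerSl subrK mulrC mulKf// gt_eqF//.
  have p0 : pochhammer (c - 1) i != 0 by rewrite gt_eqF// pochhammer_gt0.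
  have f0 : i`!%:R != 0 :> R by rewrite pnatr_eq0 -lt0n fact_gt0.
  have ci : c - 1 + i%:R != 0 by rewrite gt_eqF// ltr_wpDr.
  have -> : t ^+ i = if i is 0%N then 1 else t * t ^+ i.-1.
    by case: (i) => [|j]; rewrite ?expr0 ?exprS.
  case: i p0 f0 ci => [|i] p0 f0 ci /=.
    by rewrite mulr0n; field; rewrite f0 p0 !gt_eqF.
  have cm0 : c - 1 != 0 by rewrite gt_eqF.
  move: f0 ci; move: (i.+1`!%:R) (i.+1%:R : R) => F N f0 ci.
  by field; rewrite f0 p0 ci cm0.
rewrite (funext part) in cl; exact: (cvg_unique _ cl cr).
Qed.

Definition powhyp A B c x := (1 - x) `^ (c - 1) * hyp2F1 A B c ((1 - x) / 2).

Lemma is_derive_powhyp A B c x : 1 < c -> -1 < x < 1 ->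
  is_derive x 1 (powhyp A B c) (- (c - 1) * powhyp A B (c - 1) x).
Proof.
move=> c1 /andP[x0 x1]; have c0 : 0 < c by exact: lt_trans c1.
have t1 : `|(1 - x) / 2| < 1 by rewrite ger0_norm; lra.
have x2 : 0 < 1 - x by lra.
have d1 : is_derive x 1 (fun x : R => 1 - x) (-1).
  by apply: is_derive_eq; rewrite add0r mul1r.
have d2 := @is_derive1_comp _ _ (fun x => 1 - x) x _ _
  (is_derive1_powR (c - 1) x2) d1.
have d3 : is_derive x 1 (fun x : R => (1 - x) / 2) (- (1 / 2)).
  by apply: is_derive_eq; rewrite !scaler0 add0r /GRing.scale/=; field.
have d4 := @is_derive1_comp _ _ (fun x => (1 - x) / 2) x _ _
  (is_derive_hyp2F1 A B c0 t1) d3.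
have -> : powhyp A B c = ((fun x : R => x `^ (c - 1)) \o (fun x => 1 - x)) *
    (hyp2F1 A B c \o (fun x => (1 - x) / 2)) by [].
apply: is_derive_eq; rewrite /powhyp /GRing.scale/=.
transitivity (- (1 - x) `^ (c - 1 - 1) *
  ((c - 1) * hyp2F1 A B (c - 1) ((1 - x) / 2))); last by ring.
rewrite -hyp2F1_contiguous//.
have -> : (1 - x) `^ (c - 1) = (1 - x) * (1 - x) `^ (c - 1 - 1).
  by rewrite mulr_powRB1 ?subr_gt0// ltW.
by field; rewrite gt_eqF.
Qed.

End PowerTimesHypergeometric.

(** * Fractional integrals of the basic functions *)

Section Bateman.
Context {R : realType}.
Local Notation mu := (@lebesgue_measure R).
Implicit Types (a b c s t x y A B : R).

Lemma integrable_beta_itv a b x z : 0 < a -> 0 < b -> x < z ->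
  mu.-integrable `]x, z[
    (fun y => ((z - y) `^ (a - 1) * (y - x) `^ (b - 1))%:E).
Proof.
move=> a0 b0 xz; apply/integrableP; split.
  apply/measurable_EFinP; apply: measurable_funTS; apply: measurable_funM.
    by apply: (measurableT_comp (measurable_powR _)); exact: measurable_funB.
  by apply: (measurableT_comp (measurable_powR _)); exact: measurable_funB.
under eq_integral do rewrite abse_EFin ger0_norm ?mulr_ge0 ?powR_ge0//.
by rewrite integral_beta_itv// ltry.
Qed.

Lemma Gamma_pochhammer c n : 0 < c -> Gamma (c + n%:R) = pochhammer c n * Gamma c.
Proof.
move=> c0; elim: n => [|n IH]; first by rewrite addr0 /pochhammer big_ord0 mul1r.
have cn : 0 < c + n%:R by rewrite ltr_wpDr.
by rewrite -natr1 addrA (GammaS cn) IH pochhammerS mulrCA mulrA.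
Qed.

Lemma powR_addn x r n : 0 < x -> x `^ (r + n%:R) = x `^ r * x ^+ n.
Proof.
by move=> x0; rewrite powRD ?(gt_eqF x0) ?implybT// powR_mulrn// ltW.
Qed.

Section fixed_parameters.
Variables (A B c s x : R).
Hypotheses (c0 : 0 < c) (s0 : 0 < s) (x11 : -1 < x < 1).

Let u := hypcoef A B c.
Let w y := (1 - y) `^ (c - 1) * (y - x) `^ (s - 1).
Let term j y :=
  u j / 2 ^+ j * ((1 - y) `^ (c + j%:R - 1) * (y - x) `^ (s - 1)).

Let x1 : x < 1. Proof. by case/andP: x11. Qed.

Let termE j y : y < 1 -> term j y = u j * ((1 - y) / 2) ^+ j * w y.
Proof.
move=> y1; have y0 : 0 < 1 - y by rewrite subr_gt0.
rewrite /term /w (_ : c + j%:R - 1 = c - 1 + j%:R); last by ring.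
by rewrite powR_addn// expr_div_n; ring.
Qed.

Let integrable_term j : mu.-integrable `]x, 1[ (EFin \o term j).
Proof.
rewrite (_ : EFin \o term j = fun y => ((u j / 2 ^+ j)%:E *
   ((1 - y) `^ (c + j%:R - 1) * (y - x) `^ (s - 1))%:E)%E) //.
by apply: integrableZl => //; apply: integrable_beta_itv => //; rewrite ltr_wpDr.
Qed.

Let integral_term j : (\int[mu]_(y in `]x, 1%R[) (term j y)%:E =
  (Gamma c * Gamma s / Gamma (c + s) * (1 - x) `^ (c + s - 1) *
   (hypcoef A B (c + s) j * ((1 - x) / 2) ^+ j))%:E)%E.
Proof.
have cj : 0 < c + j%:R by rewrite ltr_wpDr.
have cs : 0 < c + s by rewrite addr_gt0.
have y0 : 0 < 1 - x by rewrite subr_gt0.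
under eq_integral do rewrite EFinM.
rewrite integralZl//; last exact: integrable_beta_itv.
rewrite integral_beta_itv// -EFinM; congr EFin.
rewrite (_ : c + j%:R + s - 1 = c + s - 1 + j%:R); last by ring.
rewrite powR_addn// (_ : c + j%:R + s = c + s + j%:R); last by ring.
rewrite !Gamma_pochhammer// /u /hypcoef expr_div_n.
have p1 : pochhammer c j != 0 by rewrite gt_eqF// pochhammer_gt0.
have p2 : pochhammer (c + s) j != 0 by rewrite gt_eqF// pochhammer_gt0.
have g1 : Gamma (c + s) != 0 by rewrite gt_eqF// Gamma_gt0.
have f0 : j`!%:R != 0 :> R by rewrite pnatr_eq0 -lt0n fact_gt0.
have q0 : 2 ^+ j != 0 :> R by rewrite expf_neq0.
move: (Gamma (c + s)) (Gamma c) (Gamma s) g1 => G1 G2 G3 g1.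
by field; rewrite p1 p2 g1 f0 q0.
Qed.

(** Bateman's fractional integral. The partial sums of the series of absolute
    values at t = (1 - x) / 2 bound those at (1 - y) / 2 for all y > x, so that
    the integrand is dominated by a multiple of [w], a Beta integrand. *)
Lemma bateman_integral :
  RLintegrable_r s (powhyp A B c) x /\
  RLint_r s (powhyp A B c) x = Gamma c / Gamma (c + s) * powhyp A B (c + s) x.
Proof.
have [x0 xlt1] : -1 < x /\ x < 1 by apply/andP.
have cs : 0 < c + s by rewrite addr_gt0.
pose t := (1 - x) / 2.
have t1 : `|t| < 1 by rewrite /t ger0_norm; lra.
pose D : set R := `]x, 1[%classic.
have mD : measurable D by exact: measurable_itv.
pose f y := (powhyp A B c y / (y - x) `^ (1 - s))%:E.
have fE y : f y = (hyp2F1 A B c ((1 - y) / 2) * w y)%:E.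
  by rewrite /f /powhyp /w -powRN opprB; congr EFin; ring.
pose f_ n y := (\sum_(0 <= j < n) term j y)%:E.
have f_E n y : y < 1 -> f_ n y = (pseries u ((1 - y) / 2) n * w y)%:E.
  move=> y1; rewrite /f_ /pseries/= /series/= mulr_suml; congr EFin.
  by apply: eq_bigr => j _; rewrite termE.
pose M := limn [normed series (fun n => u n * t ^+ n)].
have cM : cvgn [normed series (fun n => u n * t ^+ n)].
  exact: normed_hyp2F1_cvg.
have if_ n : mu.-integrable D (f_ n).
  rewrite (_ : f_ n = fun y => (\sum_(j <- index_iota 0 n) (term j y)%:E)%E).
    by apply: integrable_sum => //= j _; exact: integrable_term.
  by apply/funext => y; rewrite /f_ sumEFin.
have cvf y : D y -> f_ n y @[n --> \oo] --> f y.
  rewrite /D/= in_itv/= => /andP[xy y1]; rewrite fE.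
  rewrite (funext (fun n => f_E n y y1)).
  apply: cvg_EFin; first exact: nearW.
  apply: cvgMl; rewrite hyp2F1E; apply: hyp2F1_cvg => //.
  by rewrite ger0_norm; lra.
have iw : mu.-integrable D (EFin \o w).
  exact: integrable_beta_itv.
have fg n y : D y -> (`|f_ n y| <= M%:E * (w y)%:E)%E.
  move=> Dy; have /andP[xy y1] : x < y < 1 by move: Dy; rewrite /D/= in_itv.
  rewrite (f_E n y y1) -EFinM lee_fin normrM.
  have w0 : 0 <= w y by rewrite mulr_ge0 ?powR_ge0.
  rewrite (ger0_norm w0) ler_wpM2r//; apply: (le_trans (ler_norm_sum _ _ _)).
  apply: (@le_trans _ _ ([normed series (fun n => u n * t ^+ n)] n)); last first.
    apply: nondecreasing_cvgn_le => //.
    by apply: nondecreasing_series => *; exact: normr_ge0.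
  apply: ler_sum => j _; rewrite /= !normrM ler_wpM2l// !normrX lerXn2r ?nnegrE//.
  by rewrite /t !ger0_norm; lra.
have iMw : mu.-integrable D (fun y => M%:E * (w y)%:E)%E.
  exact: integrableZl.
have mf : measurable_fun D f.
  by apply: (emeasurable_fun_cvg f_) => // n; have /integrableP[] := if_ n.
have [intf _ cvint] : [/\ mu.-integrable D f,
    (\int[mu]_(y in D) `|f_ n y - f y|)%E @[n --> \oo] --> 0%E &
    (\int[mu]_(y in D) (f_ n y))%E @[n --> \oo] --> (\int[mu]_(y in D) f y)%E].
  apply: (@dominated_convergence _ _ _ mu D mD f_ f
    (fun y => M%:E * (w y)%:E)%E _ mf _ iMw _).
  - by move=> n; have /integrableP[] := if_ n.
  - by apply/aeW => y Dy; exact: cvf.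
  - by apply/aeW => y n Dy; exact: fg.
split; first exact: intf.
pose K := Gamma c * Gamma s / Gamma (c + s) * (1 - x) `^ (c + s - 1).
have cvK : (\int[mu]_(y in D) (f_ n y))%E @[n --> \oo] -->
    (K * hyp2F1 A B (c + s) t)%:E.
  have -> : (fun n => \int[mu]_(y in D) (f_ n y))%E =
      fun n => (K * pseries (hypcoef A B (c + s)) t n)%:E.
    apply/funext => n; rewrite /f_.
    under eq_integral do rewrite -sumEFin.
    rewrite integral_sum//; under eq_bigr do rewrite integral_term.
    by rewrite sumEFin -mulr_sumr.
  apply: cvg_EFin; first exact: nearW.
  by apply: cvgMr; rewrite hyp2F1E; exact: hyp2F1_cvg.
rewrite /RLint_r /Rintegral -/D -/f (cvg_unique _ cvint cvK)//= /K /powhyp -/t.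
have g3 : Gamma s != 0 by rewrite gt_eqF// Gamma_gt0.
have g1 : Gamma (c + s) != 0 by rewrite gt_eqF// Gamma_gt0.
move: (Gamma (c + s)) (Gamma c) (Gamma s) g1 g3 => G1 G2 G3 g1 g3.
by field; rewrite g1 g3.
Qed.

End fixed_parameters.
End Bateman.

(** * Reflection and linearity of fractional integrals *)

Section Reflection.
Context {R : realType}.
Local Notation mu := (@lebesgue_measure R).
Implicit Types (a b s x k : R) (u v : R -> R).

Lemma integral_opp (f : R -> \bar R) : measurable_fun setT f ->
  (\int[mu]_x f (- x)%R = \int[mu]_x f x)%E.
Proof.
move=> mf; rewrite integralE [RHS]integralE; congr (_ - _)%E.
- by rewrite (funepos_comp f -%R) ge0_integral_opp//; exact: measurable_funepos.
- by rewrite (funeneg_comp f -%R) ge0_integral_opp//; exact: measurable_funeneg.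
Qed.

(** Measurability of f comes with that of its reflection, since reflecting twice
    gives f back. *)
Lemma integrable_opp_itv (f : R -> \bar R) a b :
  mu.-integrable `](- b)%R, (- a)%R[ (fun y => f (- y)) ->
  mu.-integrable `]a, b[ f /\
  (\int[mu]_(y in `]a, b[) f y = \int[mu]_(y in `](- b)%R, (- a)%R[) f (- y)%R)%E.
Proof.
pose F := f \_ `]a, b[.
have FN : (fun y => f (- y)) \_ `](- b), (- a)[ = fun y => F (- y).
  apply/funext => y; rewrite /F /patch !mem_setE !in_itv/=.
  by rewrite ltrNl ltrNr andbC.
move=> /integrable_mkcond; rewrite FN => /(_ (measurable_itv _)) intN.
have mF : measurable_fun setT F.
  have /integrableP[mFN _] := intN.
  rewrite (_ : F = (fun y => F (- y)) \o -%R).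
    by apply: measurableT_comp.
  by apply/funext => y /=; rewrite opprK.
split.
  apply/integrable_mkcond => //; rewrite -/F; apply/integrableP; split => //.
  have /integrableP[_] := intN.
  by rewrite (integral_opp (f := fun y => `|F y|)%E)//; exact: measurableT_comp.
by rewrite integral_mkcond [RHS]integral_mkcond FN integral_opp.
Qed.

Lemma RLint_r_scale s u v k x : (forall y, x < y < 1 -> v y = k * u y) ->
  RLintegrable_r s u x ->
  RLintegrable_r s v x /\ RLint_r s v x = k * RLint_r s u x.
Proof.
rewrite /RLintegrable_r /RLint_r => vE iu.
have vE' y : y \in (`]x, 1[%classic : set R) ->
    v y / (y - x) `^ (1 - s) = k * (u y / (y - x) `^ (1 - s)).
  by rewrite mem_setE in_itv/= => /vE ->; rewrite mulrA.
split.
  have iku : mu.-integrable `]x, 1%R[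
      (fun y => k%:E * (u y / (y - x) `^ (1 - s))%:E)%E by exact: integrableZl.
  by apply: eq_integrable iku => // y /vE' ->.
rewrite (eq_Rintegral mu vE') RintegralZl//; ring.
Qed.

Lemma RLint_l_opp s u v k x : (forall y, -1 < y < x -> v y = k * u (- y)) ->
  RLintegrable_r s u (- x) ->
  RLintegrable_l s v x /\ RLint_l s v x = k * RLint_r s u (- x).
Proof.
move=> vE iu.
have vE' y : - x < y < 1 -> v (- y) = k * u y.
  by move=> /andP[xy y1]; rewrite vE ?opprK//; apply/andP; split; lra.
have [iw <-] := RLint_r_scale vE' iu.
move: iw; rewrite /RLintegrable_r /RLintegrable_l /RLint_r /RLint_l /Rintegral.
pose f y := (v y / (x - y) `^ (1 - s))%:E.
have fN : (fun y => (v (- y) / (y - - x) `^ (1 - s))%:E) = fun y => f (- y).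
  by apply/funext => y; rewrite /f !opprK addrC.
rewrite fN -[in X in X -> _](opprK (1 : R)) => /integrable_opp_itv[intf E].
rewrite opprK in E; split; first exact: intf.
by rewrite -E.
Qed.

End Reflection.

(** * Iterated derivatives on ]-1, 1[ *)

Section Derivatives.
Context {R : realType}.

(** The agreement of g with [f 0] on the open interval is enough, as derivatives
    only depend on the germ of a function. *)
Lemma derive1n_family (k : nat) (f : nat -> R -> R) (g : R -> R) :
  (forall x, -1 < x < 1 -> g x = f 0%N x) ->
  (forall i (x : R), (i < k)%N -> -1 < x < 1 -> is_derive x 1 (f i) (f i.+1 x)) ->
  derivable_upto k g /\ forall x, -1 < x < 1 -> derive1n k g x = f k x.
Proof.
move=> gf df.
have itv (x : R) : -1 < x < 1 -> \forall y \near x, -1 < y < 1.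
  move=> /andP[h1 h2]; near=> y; apply/andP; split; near: y.
    exact: lt_nbhsr.
  exact: lt_nbhsl.
have E i : (i <= k)%N -> forall x, -1 < x < 1 -> derive1n i g x = f i x.
  elim: i => [|i IH] ik x xI; first exact: gf.
  have [_ <-] := df i x ik xI.
  rewrite derive1nS derive1E; apply: near_eq_derive => //.
  by apply: filterS (itv x xI) => y; exact: (IH (ltnW ik)).
split; last by move=> x; exact: E.
move=> i ik x xI; have [d _] := df i x ik xI.
apply: near_eq_derivable d => //.
by apply: filterS (itv x xI) => y yI; rewrite E// ltnW.
Unshelve. all: by end_near. Qed.

End Derivatives.

(** * Generalised Gegenbauer functions *)

Section Gegenbauer.
Context {R : realType}.
Implicit Types (lambda nu s x y : R).

(** Euler's transformation cancels the factor (1 - t)^(lambda - 1/2) that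
    1 - y^2 = 2 (1 - y) (1 - t), with t = (1 - y) / 2, gives to the weight. *)
Lemma omega_rG lambda nu y : - (1 / 2) < lambda -> -1 < y < 1 ->
  omega lambda y * rG lambda nu y =
  2 `^ (lambda - 1 / 2) *
  powhyp (lambda + 1 / 2 + nu) (1 / 2 - lambda - nu) (lambda + 1 / 2) y.
Proof.
move=> l0 /andP[y0 y1]; set c := lambda + 1 / 2.
have c0 : 0 < c by rewrite /c; lra.
have t01 : 0 <= (1 - y) / 2 < 1 by apply/andP; split; lra.
set A := c + nu; set B := 1 / 2 - lambda - nu.
rewrite /rG (_ : - nu = c - A); last by rewrite /A; ring.
rewrite (_ : nu + 2 * lambda = c - B); last by rewrite /c /B; field.
rewrite -/c hyp2F1_euler// /powhyp /omega.
rewrite (_ : lambda - 1 / 2 = c - 1); last by rewrite /c; field.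
rewrite (_ : A + B - c = - (c - 1)); last by rewrite /A /B /c; field.
rewrite (_ : 1 - y ^+ 2 = 2 * (1 - y) * (1 - (1 - y) / 2)); last by field.
have h1 : 0 < 1 - y by lra.
have h2 : 0 < 1 - (1 - y) / 2 by lra.
rewrite powRM ?mulr_ge0 ?ltW// powRM ?ltW// powRN mulrA mulfK -?mulrA//.
by rewrite gt_eqF// powR_gt0.
Qed.

Lemma omegaN lambda y : omega lambda (- y) = omega lambda y.
Proof. by rewrite /omega sqrrN. Qed.

Lemma lGE lambda nu y :
  lG lambda nu y = (-1) ^ (Num.floor nu) * rG lambda nu (- y).
Proof. by rewrite /lG /rG opprK. Qed.

Lemma expN1zK (m n : int) : (-1) ^ (m + n) * (-1) ^ n = (-1) ^ m :> R.
Proof.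
by rewrite expfzDr ?oppr_eq0 ?oner_eq0// -mulrA -expfzMl mulrNN mulr1 exp1rz mulr1.
Qed.

(** The form in which the right-hand sides of the theorem are produced: the
    parameters lambda + 1/2 + nu and 1/2 - lambda - nu are unchanged by the
    shift. Integrals use it with - s in place of s. *)
Lemma hcoef_omega_rG lambda s nu x : - (1 / 2) < lambda - s -> -1 < x < 1 ->
  hcoef lambda s * omega (lambda - s) x * rG (lambda - s) (nu + s) x =
  2 `^ (lambda - 1 / 2) * Gamma (lambda + 1 / 2) / Gamma (lambda + 1 / 2 - s) *
  powhyp (lambda + 1 / 2 + nu) (1 / 2 - lambda - nu) (lambda + 1 / 2 - s) x.
Proof.
move=> ls x11; rewrite -mulrA omega_rG// /hcoef.
rewrite (_ : lambda - s + 1 / 2 = lambda + 1 / 2 - s); last by ring.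
rewrite (_ : lambda + 1 / 2 - s + (nu + s) = lambda + 1 / 2 + nu); last by ring.
rewrite (_ : 1 / 2 - (lambda - s) - (nu + s) = 1 / 2 - lambda - nu); last by ring.
rewrite (_ : lambda - 1 / 2 = s + (lambda - s - 1 / 2)); last by ring.
rewrite [in RHS]powRD ?pnatr_eq0 ?implybT//.
move: (Gamma _) (Gamma _) (powhyp _ _ _ _) => G1 G2 P; ring.
Qed.

Lemma RLint_r_gegenbauer lambda nu s x :
  0 < s -> - (1 / 2) < lambda -> -1 < x < 1 ->
  let ur := fun y => omega lambda y * rG lambda nu y in
  RLintegrable_r s ur x /\
  RLint_r s ur x =
    2 `^ (lambda - 1 / 2) * (Gamma (lambda + 1 / 2) /
    Gamma (lambda + 1 / 2 + s) *
    powhyp (lambda + 1 / 2 + nu) (1 / 2 - lambda - nu) (lambda + 1 / 2 + s) x).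
Proof.
move=> s0 l0 x11 ur; have c0 : 0 < lambda + 1 / 2 by lra.
have [ib <-] := bateman_integral (lambda + 1 / 2 + nu) (1 / 2 - lambda - nu)
  c0 s0 x11.
apply: RLint_r_scale => // y /andP[xy y1]; apply: omega_rG => //.
by case/andP: x11 => x0 _; rewrite y1 (lt_trans x0 xy).
Qed.

Lemma RLint_l_gegenbauer lambda nu s x :
  0 < s -> - (1 / 2) < lambda -> -1 < x < 1 ->
  let ur := fun y => omega lambda y * rG lambda nu y in
  let ul := fun y => omega lambda y * lG lambda nu y in
  RLintegrable_l s ul x /\
  RLint_l s ul x = (-1) ^ (Num.floor nu) * RLint_r s ur (- x).
Proof.
move=> s0 l0 /andP[x0 x1] ur ul.
have x11 : -1 < - x < 1 by apply/andP; split; lra.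
have [ir _] := RLint_r_gegenbauer nu s0 l0 x11.
apply: RLint_l_opp ir => y _; rewrite /ul lGE -omegaN.
by rewrite mulrCA.
Qed.

(** The i-th derivative of the right integral of order s of
    omega_lambda * rG_nu^lambda on ]-1, 1[, as long as i < lambda + 1/2 + s;
    dividing by the shifted Gamma value absorbs the factors produced by the
    derivatives. *)
Definition gegenbauer_family lambda nu s (i : nat) x : R :=
  (-1) ^+ i * (2 `^ (lambda - 1 / 2) * Gamma (lambda + 1 / 2) /
    Gamma (lambda + 1 / 2 + s - i%:R)) *
  powhyp (lambda + 1 / 2 + nu) (1 / 2 - lambda - nu)
    (lambda + 1 / 2 + s - i%:R) x.

(** The factor d - 1 from [is_derive_powhyp] passes from Gamma (d) to
    Gamma (d - 1). *)
Lemma is_derive_gegenbauer_family lambda nu s i x :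
  i.+1%:R < lambda + 1 / 2 + s -> -1 < x < 1 ->
  is_derive x 1 (gegenbauer_family lambda nu s i)
    (gegenbauer_family lambda nu s i.+1 x).
Proof.
move=> hi x11; rewrite /gegenbauer_family.
have -> : lambda + 1 / 2 + s - i.+1%:R = lambda + 1 / 2 + s - i%:R - 1.
  by rewrite -natr1; ring.
set d := lambda + 1 / 2 + s - i%:R.
have d1 : 1 < d by move: hi; rewrite -natr1 /d; lra.
have dm : 0 < d - 1 by rewrite subr_gt0.
have GE : Gamma d = (d - 1) * Gamma (d - 1) by rewrite -(GammaS dm) subrK.
have gn : Gamma (d - 1) != 0 by rewrite gt_eqF// Gamma_gt0.
have der := is_derive_powhyp (lambda + 1 / 2 + nu) (1 / 2 - lambda - nu) d1 x11.
apply: is_derive_eq.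
rewrite GE /GRing.scale/= exprS.
move: gn; move: (Gamma (d - 1)) (Gamma _) (powhyp _ _ _ _) => G1 G2 P gn.
by field; rewrite gn gt_eqF.
Qed.

Lemma gegenbauer_family0 lambda nu s x :
  0 < s -> - (1 / 2) < lambda -> -1 < x < 1 ->
  RLint_r s (fun y => omega lambda y * rG lambda nu y) x =
  gegenbauer_family lambda nu s 0 x.
Proof.
move=> s0 l0 x11; have [_ ->] := RLint_r_gegenbauer nu s0 l0 x11.
by rewrite /gegenbauer_family expr0 !mul1r mulr0n subr0 !mulrA.
Qed.

Lemma gegenbauer_family_order lambda nu s (k : nat) x :
  - (1 / 2) < lambda - s -> -1 < x < 1 ->
  gegenbauer_family lambda nu (k%:R - s) k x =
  (-1) ^+ k * (hcoef lambda s * omega (lambda - s) x * rG (lambda - s) (nu + s) x).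
Proof.
move=> ls x11; rewrite hcoef_omega_rG// /gegenbauer_family.
rewrite (_ : lambda + 1 / 2 + (k%:R - s) - k%:R = lambda + 1 / 2 - s); last by ring.
by rewrite [RHS]mulrA.
Qed.

End Gegenbauer.

Theorem theorem1 (R : realType) :
  (forall nu s lambda : R, 0 < s -> s <= nu -> - (1 / 2) < lambda ->
     forall x : R, -1 < x < 1 ->
     let ur := fun y : R => omega lambda y * rG lambda nu y in
     let ul := fun y : R => omega lambda y * lG lambda nu y in
     [/\ RLintegrable_r s ur x,
         RLint_r s ur x =
           hcoef lambda (- s) * omega (lambda + s) x * rG (lambda + s) (nu - s) x,
         RLintegrable_l s ul x &
         RLint_l s ul x =
           (-1) ^ (Num.floor nu + Num.floor (nu - s)) * hcoef lambda (- s) *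
           omega (lambda + s) x * lG (lambda + s) (nu - s) x]) /\
  (forall nu s lambda : R, 0 < s -> s - 1 / 2 < lambda -> 0 <= nu ->
     let ur := fun y : R => omega lambda y * rG lambda nu y in
     let ul := fun y : R => omega lambda y * lG lambda nu y in
     RLderivable_r s ur /\ RLderivable_l s ul /\
     forall x : R, -1 < x < 1 ->
       RLder_r s ur x =
         hcoef lambda s * omega (lambda - s) x * rG (lambda - s) (nu + s) x /\
       RLder_l s ul x =
         (-1) ^ (Num.floor nu + Num.floor (nu + s)) * hcoef lambda s *
         omega (lambda - s) x * lG (lambda - s) (nu + s) x).
Proof.
have opp_itv (x : R) : -1 < x < 1 -> -1 < - x < 1.
  by move=> /andP[x0 x1]; apply/andP; split; lra.
split.
  move=> nu s lambda s0 _ l0 x x11 ur ul.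
  have right y : -1 < y < 1 -> RLintegrable_r s ur y /\ RLint_r s ur y =
      hcoef lambda (- s) * omega (lambda + s) y * rG (lambda + s) (nu - s) y.
    move=> y11; have [ir ->] := RLint_r_gegenbauer nu s0 l0 y11; split => //.
    have ls : - (1 / 2) < lambda - - s by lra.
    have := hcoef_omega_rG nu ls y11; rewrite !opprK => ->.
    by rewrite !mulrA.
  have [ir rE] := right x x11.
  have [_ rNE] := right (- x) (opp_itv x x11).
  have [il lE] := RLint_l_gegenbauer nu s0 l0 x11.
  split => //; rewrite lE rNE omegaN lGE -(expN1zK _ (Num.floor (nu - s))).
  by ring.
move=> nu s lambda s0 ls nu0 ur ul.
have l0 : - (1 / 2) < lambda by lra.
have lms : - (1 / 2) < lambda - s by lra.
set k := RLorder s; set t := k%:R - s.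
have /andP[_ sk] := RLorder_itv (ltW s0); rewrite -/k in sk.
have t0 : 0 < t by rewrite subr_gt0.
have df i (x : R) : (i < k)%N -> -1 < x < 1 ->
    is_derive x 1 (gegenbauer_family lambda nu t i)
      (gegenbauer_family lambda nu t i.+1 x).
  move=> ik; apply: is_derive_gegenbauer_family.
  have : i.+1%:R <= k%:R :> R by rewrite ler_nat.
  by rewrite /t; lra.
have [dr rE] := derive1n_family (fun x => gegenbauer_family0 nu t0 l0) df.
pose fl i x :=
  (-1) ^ (Num.floor nu) * ((-1) ^+ i * gegenbauer_family lambda nu t i (- x)).
have [dl lE] : derivable_upto k (RLint_l t ul) /\
    forall x : R, -1 < x < 1 -> derive1n k (RLint_l t ul) x = fl k x.
  apply: derive1n_family => [x x11|i x ik x11].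
    have [_ ->] := RLint_l_gegenbauer nu t0 l0 x11.
    by rewrite /fl expr0 mul1r gegenbauer_family0//; exact: opp_itv.
  have d1 := df i (- x) ik (opp_itv x x11).
  have d2 := @is_derive1_comp _ _ -%R x _ _ d1 (is_deriveNid x 1).
  have -> : fl i = ((-1) ^ (Num.floor nu) * (-1) ^+ i) *:
      (gegenbauer_family lambda nu t i \o -%R).
    by apply/funext => y; rewrite /fl mulrA.
  apply: is_derive_eq; rewrite /fl /GRing.scale/= exprS; ring.
split; last split.
- split; last exact: dr.
  by move=> x x11; have [ir _] := RLint_r_gegenbauer nu t0 l0 x11; exact: ir.
- split; last exact: dl.
  by move=> x x11; have [il _] := RLint_l_gegenbauer nu t0 l0 x11; exact: il.
move=> x x11; rewrite /RLder_r /RLder_l -/k -/t (rE x x11) (lE x x11) /fl.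
have sq (z : R) : (-1) ^+ k * ((-1) ^+ k * z) = z.
  by rewrite mulrA -exprMn mulrNN mulr1 expr1n mul1r.
rewrite !gegenbauer_family_order ?opp_itv// !sq; split => //.
rewrite omegaN lGE -(expN1zK _ (Num.floor (nu + s))).
by ring.
Qed.
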